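(* Let $M=(E,\mathcal{I})$ be a loopless matroid (no loops and no coloops), let $e\in E$, and let $x,z:E\to\mathbb{R}$ be weightings that differ only in the weight given to $e$ (i.e. $x(f)=z(f)$ for all $f\neq e$). Then $$\tau_M(z)-\tau_M(x)=\beta_z(e)-\beta_x(e).$$
   Context: Bases are maximal independent sets, circuits are minimal dependent sets, an $e$-circuit is a circuit containing $e$. A loop is an element $e$ with $\{e\}$ dependent; a coloop is an element lying in every basis. For a weighting $x:E\to\mathbb{R}$, $x(F)=\sum_{f\in F}x(f)$ and $\tau_M(x)=\min_{B\text{ basis}}x(B)$. The min-max weight is $\mu_x(e)=\min_{C\ e\text{-circuit}}\max_{f\in C\setminus\{e\}}x(f)$ and the bottleneck weight is $\beta_x(e)=\min\{x(e),\mu_x(e)\}$. *)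

(* Defs.v *)
From HB Require Import structures.
From mathcomp Require Import all_boot all_order all_algebra.
From mathcomp Require Import reals.

Set Implicit Arguments.
Unset Strict Implicit.
Unset Printing Implicit Defensive.

Import Order.TTheory GRing.Theory Num.Theory.
Local Open Scope ring_scope.

(* The ground set is the whole of the finite type [E]. *)
Record matroid (E : finType) := Matroid {
  indep : pred {set E};
  indep0 : indep set0;
  indepS : forall A B : {set E}, A \subset B -> indep B -> indep A;
  indep_aug : forall A B : {set E}, indep A -> indep B -> (#|A| < #|B|)%N ->
    exists2 f, f \in B :\: A & indep (f |: A)
}.

Section MatroidNotions.
Variables (E : finType) (M : matroid E).
Implicit Types (B C : {set E}) (e : E).

Definition basis B : bool := maxset (indep M) B.
Definition circuit C : bool := minset [pred A | ~~ indep M A] C.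
Definition ecircuit e C : bool := circuit C && (e \in C).

Definition loop e : bool := ~~ indep M [set e].
Definition coloop e : bool := [forall B, basis B ==> (e \in B)].

(* Excludes coloops as well as loops. *)
Definition loopless : Prop := forall e, ~~ loop e /\ ~~ coloop e.

End MatroidNotions.

(* Minimum and maximum of [F] over the indices satisfying [P]; the value 0 is
   a junk value, returned only when no index satisfies [P]. *)
Section FiniteMinMax.
Variables (R : realType) (I : finType) (P : pred I) (F : I -> R).

Definition fmin : R :=
  if [pick i | P i] is Some i0 then F [arg min_(i < i0 | P i) F i]%O else 0.
Definition fmax : R :=
  if [pick i | P i] is Some i0 then F [arg max_(i > i0 | P i) F i]%O else 0.

Lemma fminP i0 : P i0 ->
  (exists2 i, P i & fmin = F i) /\ (forall i, P i -> fmin <= F i).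
Proof.
rewrite /fmin; case: pickP => [j Pj _ | P0]; last by rewrite P0.
by case: arg_minP => // i Pi le_i; split; first exists i.
Qed.

Lemma fmaxP i0 : P i0 ->
  (exists2 i, P i & fmax = F i) /\ (forall i, P i -> F i <= fmax).
Proof.
rewrite /fmax; case: pickP => [j Pj _ | P0]; last by rewrite P0.
by case: arg_maxP => // i Pi le_i; split; first exists i.
Qed.

End FiniteMinMax.

Section Weights.
Variables (R : realType) (E : finType) (M : matroid E) (x : E -> R).

Definition weight (F : {set E}) : R := \sum_(f in F) x f.
Definition tau : R := fmin (basis M) weight.
(* In a loopless matroid both index sets are nonempty: an e-circuit exists
   since e is not a coloop, and C :\ e != set0 since e is not a loop. *)
Definition mu (e : E) : R :=
  fmin (ecircuit M e) (fun C : {set E} => fmax [in C :\ e] x).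
Definition beta (e : E) : R := Num.min (x e) (mu e).

End Weights.

(* Main.v *)
Require Import Defs.
From HB Require Import structures.
From mathcomp Require Import all_boot all_order all_algebra.
From mathcomp Require Import reals lra.

Set Implicit Arguments.
Unset Strict Implicit.
Unset Printing Implicit Defensive.

Import Order.TTheory GRing.Theory Num.Theory.
Local Open Scope ring_scope.

(** Let [W] be the least weight of [B :\ e] over the bases [B] containing [e].
    Then [tau M x = W + beta M x e], and [W] ignores [x e].  A basis through
    [e] of weight [W + x e] can trade [e] for an element of a circuit attaining
    [mu M x e]; conversely a basis avoiding [e] can trade the heaviest element
    of its fundamental [e]-circuit for [e]. *)

Section MatroidExchange.
Variables (E : finType) (M : matroid E).
Implicit Types (A B C I J : {set E}) (e f : E).

(** A maximal independent set between [I] and [I :|: B] is no smaller than [B]: otherwise augmenting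
    it from [B] would stay inside [I :|: B]. *)
Lemma indep_extend I B : indep M I -> indep M B ->
  exists J, [/\ I \subset J, J \subset I :|: B, indep M J & (#|B| <= #|J|)%N].
Proof.
move=> indI indB; pose P := [pred J : {set E} | indep M J & J \subset I :|: B].
have PI : P I by rewrite /= indI subsetUl.
have [J /maxsetP[/andP[indJ sJ] maxJ] sIJ] := maxset_exists PI.
exists J; split=> //; rewrite leqNgt; apply/negP => ltJB.
have [f /setDP[Bf Jf] indfJ] := indep_aug indJ indB ltJB.
case/negP: Jf; rewrite -(maxJ (f |: J)) ?setU11 ?subsetUr //=.
by rewrite indfJ subUset sub1set inE Bf orbT sJ.
Qed.

Lemma basis_indep B : basis M B -> indep M B.
Proof. exact: maxsetp. Qed.

Lemma indep_card_basis B J : basis M B -> indep M J -> (#|J| <= #|B|)%N.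
Proof.
move=> /maxsetP[indB maxB] indJ; rewrite leqNgt; apply/negP => ltBJ.
have [f /setDP[_ Bf] indf] := indep_aug indB indJ ltBJ.
by case/negP: Bf; rewrite -(maxB (f |: B)) ?setU11 ?subsetUr.
Qed.

Lemma basis_card B J : basis M B -> indep M J -> (#|B| <= #|J|)%N ->
  basis M J.
Proof.
move=> basB indJ leBJ; apply/maxsetP; split=> // K indK sJK; apply/esym/eqP.
by rewrite eqEcard sJK (leq_trans (indep_card_basis basB indK)).
Qed.

Lemma circuit_dep C J : circuit M C -> C \subset J -> ~~ indep M J.
Proof. by move/minsetp => depC /(indepS (m := M)) sCJ; apply: contra depC. Qed.

Lemma circuitD1_indep C f : circuit M C -> f \in C -> indep M (C :\ f).
Proof.
move=> /minsetP[_ minC] Cf; apply/negPn/negP => dep.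
by move: Cf; rewrite -(minC _ dep (subD1set _ _)) setD11.
Qed.

(** Extend [C :\ e] by elements of [B] to an independent [J] with at least [#|B|] elements. It
    avoids [e], as it would otherwise contain [C], so augmenting [B :\ e] from [J] adds an element
    outside [B], which must come from [C]. *)
Lemma basis_exchange_circuit B C e : basis M B -> e \in B -> ecircuit M e C ->
  exists f, [/\ f \in C :\ e, f \notin B & basis M (f |: B :\ e)].
Proof.
move=> basB Be /andP[cirC Ce]; have indB := basis_indep basB.
have [J [sCJ sJ indJ leBJ]] := indep_extend (circuitD1_indep cirC Ce) indB.
have Je : e \notin J.
  apply: contraL indJ => Je; apply: circuit_dep cirC _.
  by rewrite -(setD1K Ce) subUset sub1set Je.
have cardB : #|B| = #|B :\ e|.+1 by rewrite (cardsD1 e) Be.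
have indBe : indep M (B :\ e) by apply: indepS indB; exact: subD1set.
have ltBJ : (#|B :\ e| < #|J|)%N by rewrite -cardB.
have [f /setDP[Jf nBf] indf] := indep_aug indBe indJ ltBJ.
have fe : f != e by apply: contraNneq Je => <-.
have Bf : f \notin B by move: nBf; rewrite !inE fe.
exists f; split=> //.
  by move/subsetP: sJ => /(_ _ Jf); rewrite inE (negPf Bf) orbF.
by apply: basis_card basB indf _; rewrite cardsU1 nBf cardB.
Qed.

(** [C] is a minimal dependent subset of [e |: B]; it contains [e] because [B] is independent. *)
Lemma fundamental_circuit B e : basis M B -> e \notin B ->
  exists2 C, ecircuit M e C &
    forall f, f \in C :\ e -> f \in B /\ basis M (e |: B :\ f).
Proof.
move=> basB nBe; have indB := basis_indep basB.
have dep : [pred A | ~~ indep M A] (e |: B).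
  apply/negP => /(indep_card_basis basB).
  by rewrite cardsU1 nBe add1n ltnn.
have [C cirC sC] := minset_exists dep.
have Ce : e \in C.
  apply: contraLR indB => nCe; apply: (circuit_dep cirC).
  apply/subsetP => g Cg; move/subsetP: sC => /(_ _ Cg); rewrite in_setU1.
  by case/predU1P => // ge; rewrite -ge Cg in nCe.
exists C => [|f /setD1P[fe Cf]]; first exact/andP.
have Bf : f \in B.
  by move/subsetP: sC => /(_ _ Cf); rewrite in_setU1 (negPf fe).
split=> //.
have [J [sCJ sJ indJ leBJ]] := indep_extend (circuitD1_indep cirC Cf) indB.
have Jf : f \notin J.
  apply: contraL indJ => Jf; apply: circuit_dep cirC _.
  by rewrite -(setD1K Cf) subUset sub1set Jf.
(* [J] lies in [e |: B] and misses [f], so its size forces equality. *)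
suff <- : J = e |: B :\ f by exact: basis_card basB indJ leBJ.
apply/eqP; rewrite eqEcard; apply/andP; split.
  apply/subsetP => g Jg; have gf : g != f by apply: contraNneq Jf => <-.
  move/subsetP: sJ => /(_ _ Jg); rewrite !inE gf /=.
  case/orP => [Cg|->]; last by rewrite orbT.
  by move/subsetP: sC => /(_ _ Cg); rewrite !inE.
apply: leq_trans leBJ; rewrite cardsU1 (cardsD1 f B) Bf leq_add2r.
exact: leq_b1.
Qed.

Lemma nonloop_basis e : ~~ loop M e -> exists2 B, basis M B & e \in B.
Proof.
rewrite negbK => inde; have [B basB] := maxset_exists inde.
by rewrite sub1set => Be; exists B.
Qed.

Lemma noncoloop_ecircuit e : ~~ coloop M e -> exists C, ecircuit M e C.
Proof.
case/forallPn => B; rewrite negb_imply => /andP[basB nBe].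
by have [C eC _] := fundamental_circuit basB nBe; exists C.
Qed.

(** Ensures that the inner maximum in [mu] is attained and is not the default 0. *)
Lemma ecircuitD1_neq0 e C : ~~ loop M e -> ecircuit M e C ->
  exists f, f \in C :\ e.
Proof.
move=> nle /andP[cirC Ce]; apply/set0Pn/negP => /eqP C0.
move: nle; rewrite negbK; apply/negP; apply: circuit_dep cirC _.
by rewrite -(setD1K Ce) C0 setU0.
Qed.

End MatroidExchange.

Lemma eq_fmin (R : realType) (I : finType) (P : pred I) (F G : I -> R) :
  (forall i, P i -> F i = G i) -> fmin P F = fmin P G.
Proof.
move=> eqFG.
case: (pickP P) => [i0 Pi0|P0]; last first.
  (* With no index, both sides are the default 0. *)
  by rewrite /fmin; case: pickP => // i; rewrite P0.
have [[i Pi eF] leF] := fminP F Pi0; have [[j Pj eG] leG] := fminP G Pi0.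
apply/le_anti/andP; split.
  by rewrite eG -eqFG ?leF.
by rewrite eF eqFG ?leG.
Qed.

Section TauBeta.
Variables (R : realType) (E : finType) (M : matroid E) (e : E).
Implicit Types (x z : E -> R) (A B : {set E}).

(** When [e] is not a loop, this is the least basis weight of the contraction of [M] by [e]. *)
Definition rest_weight x : R :=
  fmin [pred B | basis M B & e \in B] (fun B => weight x (B :\ e)).

Lemma eq_rest_weight x z : (forall f, f != e -> x f = z f) ->
  rest_weight x = rest_weight z.
Proof.
move=> eqxz; apply: eq_fmin => B _; apply: eq_bigr => f /setD1P[fe _].
exact: eqxz.
Qed.

Lemma weightU1 x f A : f \notin A -> weight x (f |: A) = x f + weight x A.
Proof. exact: big_setU1. Qed.

Lemma weightD1 x f A : f \in A -> weight x A = x f + weight x (A :\ f).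
Proof. exact: big_setD1. Qed.

Lemma tau_rest_beta x : ~~ loop M e -> ~~ coloop M e ->
  tau M x = rest_weight x + beta M x e.
Proof.
move=> nle ncle.
have [B0 basB0 B0e] := nonloop_basis nle.
have [C0 eC0] := noncoloop_ecircuit ncle.
have PB0 : [pred B | basis M B & e \in B] B0 by rewrite /= basB0.
have [[B /andP[basB Be] eqW] leW] :=
  fminP (fun B : {set E} => weight x (B :\ e)) PB0.
have [[T basT eqT] leT] := fminP (weight x) basB0.
have [[C eC eqmu] lemu] :=
  fminP (fun C : {set E} => fmax [in C :\ e] x) eC0.
rewrite -/(rest_weight x) in eqW leW; rewrite -/(tau M x) in eqT leT.
rewrite -/(mu M x e) in eqmu lemu.
have [be_x be_mu] : beta M x e <= x e /\ beta M x e <= mu M x e.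
  by rewrite !ge_min !lexx orbT.
apply/le_anti/andP; split.
  have tau_x : tau M x <= rest_weight x + x e.
    by rewrite eqW addrC -weightD1 ?leT.
  have tau_mu : tau M x <= rest_weight x + mu M x e.
    have [f [Cf nBf basf]] := basis_exchange_circuit basB Be eC.
    (* Since [C] attains [mu M x e], every element of [C :\ e] weighs at most that much. *)
    have [_ /(_ f Cf) lef] := @fmaxP R _ [in C :\ e] x f Cf.
    apply: le_trans (leT _ basf) _.
    by rewrite weightU1 ?inE ?(negPf nBf) ?andbF // -eqW addrC lerD2l eqmu.
  by rewrite /beta minEle; case: ifP.
(* For the converse bound, take an optimal basis [T]. If it contains [e], then [T :\ e] competes in
   the minimum [rest_weight x]. *)
have [Te|nTe] := boolP (e \in T).
  have := leW T; rewrite /= basT Te => /(_ isT) leWT.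
  by move: eqT; rewrite (weightD1 x Te) => eqT; lra.
have [D eD exD] := fundamental_circuit basT nTe.
have [g Dg] := ecircuitD1_neq0 nle eD.
(* Choosing [f] heaviest in [D :\ e] makes [x f] an upper bound for [mu M x e]. *)
have [[f Df eqf] _] := @fmaxP R _ [in D :\ e] x g Dg.
have [Tf basf] := exD f Df; have fe : f != e by case/setD1P: Df.
have := leW (e |: T :\ f); rewrite /= basf setU11 => /(_ isT).
have nTfe : e \notin T :\ f by rewrite inE (negPf nTe) andbF.
(* Removing [e] from the new basis leaves [T :\ f], of weight [tau M x - x f]. *)
rewrite setU1K // => leWT; have := lemu D eD; rewrite eqf => le_mu.
by move: eqT; rewrite (weightD1 x Tf) => eqT; lra.
Qed.

End TauBeta.

Theorem mainTheorem2 (R : realType) (E : finType) (M : matroid E) (e : E)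
    (x z : E -> R) (hM : loopless M)
    (hxz : forall f : E, f != e -> x f = z f) :
  tau M z - tau M x = beta M z e - beta M x e.
Proof.
have [nle ncle] := hM e.
(* The common term [rest_weight] cancels in the difference. *)
rewrite !(tau_rest_beta _ nle ncle) (eq_rest_weight M hxz); lra.
Qed.
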